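(* Let $m>3$ be an integer and $r$ the number of distinct prime divisors of $m$. Let $(C_n)_{n\in\mathbb{N}}$ be a family of $\mathbf{Sym}_n$-symmetric rigid $\mathrm{MOD}_m$-circuits, $C_n$ on variables $x_1,\dots,x_n$, such that for every $n$ every gate $g$ of $C_n$ has a defined support $\mathrm{supp}(g)$, and $\max_{g}|\mathrm{supp}(g)| < (n/m)^{1/r}$ for all $n\in\mathbb{N}$. Then $C_n$ does not compute $\mathrm{AND}_n$.
   Context: $\mathrm{MOD}_m^R$ ($R\subseteq\mathbb{Z}_m$) outputs $1$ on Boolean inputs iff their sum mod $m$ lies in $R$. A $\mathrm{MOD}_m$-circuit on $x_1,\dots,x_n$ is a finite DAG with multiwires and one output gate, one input gate per variable, other gates labelled by some $\mathrm{MOD}_m^R$ and evaluated on children's values with wire multiplicity. $C$ is $\mathbf{Sym}_n$-symmetric if every $\pi\in\mathbf{Sym}_n$ extends to a circuit automorphism (preserving gate labels and wire multiplicities) mapping the input gate of $x_i$ to that of $x_{\pi(i)}$; rigid if the only automorphism fixing all input gates is the identity, so $\mathbf{Sym}_n$ acts on gates and $\mathrm{Stab}(g)=\{\pi:\pi(g)=g\}$. $S\subseteq[n]$ is a support of $\Delta\le\mathbf{Sym}_n$ if every permutation fixing $S$ pointwise lies in $\Delta$; $\mathrm{supp}(g)$ is the unique inclusion-minimal support of $\mathrm{Stab}(g)$ (defined when it exists and is unique).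
   Formalization: supp(g) is taken among supports with fewer than n/2 elements, as otherwise input gates have no unique minimal support for n≥2; supports and bound are assumed only at the given n, with n≥2, as the bound cannot hold for all n; automorphisms also fix the output gate. *)

(* Defs.v *)
From HB Require Import structures.
From mathcomp Require Import all_boot all_order all_fingroup all_algebra.

Set Implicit Arguments.
Unset Strict Implicit.
Unset Printing Implicit Defensive.

(* The gates are 'I_n + I: [inl i] is the input gate of the i-th variable, and
   [inr g] is an internal gate. The number of parallel wires from c to d is
   [multiplicity w c d]; no wire enters an input gate. *)
Definition multiplicity n (I : finType) (w : 'I_n + I -> I -> nat)
    (c d : 'I_n + I) : nat :=
  if d is inr g then w c g else 0.

Definition acyclic (T : finType) (e : rel T) : Prop :=
  forall (x : T) (p : seq T), path e x p -> last x p = x -> p = [::].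

(* Only meaningful for 1 < m, since 'Z_m is the ring of integers mod m only
   in that case. *)
Record circuit (m n : nat) := Circuit {
  internal : finType;
  modset : internal -> {set 'Z_m};
  wires : 'I_n + internal -> internal -> nat;
  output : 'I_n + internal;
  wires_acyclic : acyclic [rel c d | 0 < multiplicity wires c d]
}.

Definition gate m n (C : circuit m n) : finType := ('I_n + internal C)%type.

Definition mult m n (C : circuit m n) (c d : gate C) : nat :=
  multiplicity (@wires m n C) c d.

Definition input m n (C : circuit m n) (i : 'I_n) : gate C := inl i.

(* The label R of a MOD_m^R gate; None for an input gate. *)
Definition label m n (C : circuit m n) (g : gate C) : option {set 'Z_m} :=
  if g is inr h then Some (modset h) else None.

Definition MOD m (R : {set 'Z_m}) (s : nat) : bool := (s%:R)%R \in R.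

Definition step m n (C : circuit m n) (x : 'I_n -> bool) (v : gate C -> bool)
    (g : gate C) : bool :=
  match g with
  | inl i => x i
  | inr h => MOD (modset h) (\sum_(c : gate C) wires c h * v c)
  end.

(* As C is acyclic, #|gate C| rounds reach the unique valuation of the gates,
   see eval_input and eval_internal. *)
Definition eval m n (C : circuit m n) (x : 'I_n -> bool) : gate C -> bool :=
  iter #|gate C| (step x) (fun _ => false).

Definition computes m n (C : circuit m n) (f : ('I_n -> bool) -> bool) : Prop :=
  forall x : 'I_n -> bool, eval x (output C) = f x.

Definition AND n (x : 'I_n -> bool) : bool := [forall i, x i].

Definition automorphism m n (C : circuit m n) (s : {perm gate C}) : bool :=
  [&& [forall g, label (s g) == label g],
      [forall c, forall d, mult (s c) (s d) == mult c d]
    & s (output C) == output C].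

Definition extends m n (C : circuit m n) (p : 'S_n) (s : {perm gate C}) : bool :=
  automorphism s && [forall i, s (input C i) == input C (p i)].

Definition Sym_symmetric m n (C : circuit m n) : Prop :=
  forall p : 'S_n, exists s : {perm gate C}, extends p s.

Definition rigid m n (C : circuit m n) : Prop :=
  forall s : {perm gate C}, automorphism s ->
    (forall i, s (input C i) = input C i) -> s = 1%g.

(* When C is symmetric and rigid, [gate_perm C p] is the unique automorphism
   of C extending p, see gate_permP and gate_perm_uniq. *)
Definition gate_perm m n (C : circuit m n) (p : 'S_n) : {perm gate C} :=
  odflt 1%g [pick s | extends p s].

Definition Stab m n (C : circuit m n) (g : gate C) : {set 'S_n} :=
  [set p | gate_perm C p g == g].

Definition is_support n (D : {set 'S_n}) (A : {set 'I_n}) : bool :=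
  [forall p : 'S_n, [forall i in A, p i == i] ==> (p \in D)].

(* The condition #|A| < n / 2 is the usual proviso in the notion of minimal
   support. Without it uniqueness always fails: for n > 1 both {i} and its
   complement are inclusion-minimal supports of the stabiliser of i. *)
Definition minimal_supports n (D : {set 'S_n}) : {set {set 'I_n}} :=
  [set A | minset (is_support D) A & #|A|.*2 < n].

Definition supp m n (C : circuit m n) (g : gate C) : option {set 'I_n} :=
  unset1 (minimal_supports (Stab g)).

Definition supp_defined m n (C : circuit m n) (g : gate C) : Prop :=
  exists A, supp g = Some A.

Definition supp_size m n (C : circuit m n) (g : gate C) : nat :=
  if supp g is Some A then #|A| else 0.

(* For n > 1 the support of an input gate is not empty, so a bound
   max_supp_size C < (n / m)^(1/r) can only hold if m < n. For n = 1 all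
   supports are empty, and the circuit whose output is its only input gate
   computes AND_1. Hence bounds of this form are imposed length by length,
   and only for n > 1. *)
Definition max_supp_size m n (C : circuit m n) : nat :=
  \max_(g : gate C) supp_size g.

Lemma acyclic_uniq (T : finType) (e : rel T) x p :
  acyclic e -> path e x p -> uniq (x :: p).
Proof.
move=> ac; elim: p x => [|y p IHp] x //= /andP[exy pyp].
rewrite -[(y \notin p) && uniq p]/(uniq (y :: p)) IHp // andbT.
apply/negP => xp.
have pxp : path e x (y :: p) by rewrite /= exy.
case/splitPl: xp pxp => p1 p2 lastp1; rewrite -cat_cons cat_path => /andP[pp1 _].
by have := ac x (y :: p1) pp1 lastp1.
Qed.

Lemma eval_step m n (C : circuit m n) (x : 'I_n -> bool) (g : gate C) :
  step x (eval x) g = eval x g.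
Proof.
pose v k : gate C -> bool := iter k (step x) (fun _ => false).
have pathv k h : v k.+1 h != v k h -> exists y p,
  [/\ path [rel c d | 0 < mult c d] y p, last y p = h & size p = k].
  elim: k h => [|k IHk] h; first by exists h, [::].
  case: h => [i|h]; first by rewrite /= eqxx.
  case: (boolP [exists c, (0 < wires c h) && (v k.+1 c != v k c)]).
    case/existsP=> c /andP[wch /IHk[y [p [yp lastp sizep]]]] _.
    exists y, (rcons p (inr h)).
    by rewrite rcons_path yp lastp /= wch last_rcons size_rcons sizep.
  rewrite negb_exists => /forallP nw /eqP[]; congr MOD.
  apply: eq_bigr => c _; have := nw c; rewrite negb_and -leqNgt leqn0 negbK.
  by case/orP => /eqP => [->|] //= E; congr (_ * nat_of_bool _).
apply/eqP/negPn/negP => /(pathv #|gate C|)[y [p [yp _ sizep]]].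
have := acyclic_uniq (@wires_acyclic m n C) yp.
move/card_uniqP => card; have := max_card [in y :: p].
by rewrite card /= sizep ltnn.
Qed.

Lemma eval_input m n (C : circuit m n) (x : 'I_n -> bool) (i : 'I_n) :
  eval x (input C i) = x i.
Proof. by rewrite -eval_step. Qed.

Lemma eval_internal m n (C : circuit m n) (x : 'I_n -> bool) (h : internal C) :
  eval x (inr h : gate C)
    = MOD (modset h) (\sum_(c : gate C) mult c (inr h : gate C) * eval x c).
Proof. by rewrite -eval_step. Qed.

Lemma gate_permP m n (C : circuit m n) (p : 'S_n) :
  Sym_symmetric C -> extends p (gate_perm C p).
Proof.
rewrite /gate_perm => symC; case: pickP => //= nexts.
by case: (symC p) => s; rewrite nexts.
Qed.

Lemma gate_perm_uniq m n (C : circuit m n) (p : 'S_n) (s t : {perm gate C}) :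
  rigid C -> extends p s -> extends p t -> s = t.
Proof.
move=> rigC /andP[/and3P[/forallP sl /forallP sw /eqP so] /forallP si].
case/andP=> /and3P[/forallP tl /forallP tw /eqP to] /forallP ti.
apply/eqP; rewrite eq_mulgV1; apply/eqP/rigC => [|i]; last first.
  by rewrite permM (eqP (si i)) -(eqP (ti i)) permK.
apply/and3P; split; last by rewrite permM so -[in X in X == _]to permK.
  by apply/forallP=> g; rewrite permM -(eqP (tl _)) permKV.
apply/forallP=> c; apply/forallP=> d; rewrite !permM.
by have /forallP/(_ ((t^-1)%g (s d)))/eqP<- := tw ((t^-1)%g (s c));
  rewrite !permKV; have /forallP := sw c.
Qed.

(* Main.v *)
(* Let k bound the supports. By induction on the depth, the value of a gate g
   depends only on the input bits in supp g and on the Hamming weight of the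
   input modulo M = m * prod_(p | m) p^(floor(log_p k)). Indeed, group the
   children of g by their support T, and the sets T by their trace on
   S = supp g and by the numbers a and b of ones and zeros of the input on
   T \ S. Permutations fixing S pointwise fix g, and those which also preserve
   the input act transitively on each class, so by symmetry all T of a class
   contribute equally to the sum computed at g. The size of a class is
   C(w, a) * C(w', b), where w and w' are the numbers of ones and zeros outside
   S; modulo m it depends only on w modulo M because a, b <= k.
   The output gate has empty support, so it cannot distinguish the weights n
   and n - M, while M <= m * k^r < n. *)
Require Import Defs.
From mathcomp Require Import all_boot all_order all_fingroup all_algebra.
From mathcomp Require Import reals exp.

Set Implicit Arguments.
Unset Strict Implicit.
Unset Printing Implicit Defensive.

(** * Periodicity of binomial coefficients modulo [m] *)

(* A common period, modulo m, of the functions w |-> 'C(w, j) for j <= k. *)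
Definition bin_period (m k : nat) : nat :=
  m * \prod_(p <- primes m) p ^ trunc_log p k.

Lemma bin_period_gt0 m k : 0 < m -> 0 < bin_period m k.
Proof.
move=> m_gt0; rewrite muln_gt0 m_gt0 /= big_seq_cond; apply: prodn_cond_gt0.
by move=> p /andP[]; rewrite mem_primes expn_gt0 => /andP[/prime_gt0->].
Qed.

Lemma bin_period_le m k : 0 < k -> bin_period m k <= m * k ^ size (primes m).
Proof.
move=> k_gt0; rewrite leq_mul2l; apply/orP; right.
have: all prime (primes m) by apply/allP => p; rewrite mem_primes => /andP[].
elim: (primes m) => [|p s IHs] /=; first by rewrite big_nil.
case/andP=> /prime_gt1 p_gt1 /IHs le_s; rewrite big_cons expnS.
by rewrite leq_mul ?trunc_logP.
Qed.

(* For M = bin_period m k, i * 'C(M, i) = M * 'C(M.-1, i.-1), and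
   logn p i <= trunc_log p k. *)
Lemma dvdn_bin_period m k i : 0 < m -> 0 < i <= k -> m %| 'C(bin_period m k, i).
Proof.
move=> m_gt0 /andP[]; case: i => // i _ ltik.
have [->|bin_gt0] := posnP 'C(bin_period m k, i.+1); first exact: dvdn0.
have := mul_bin_diag (bin_period m k) i.
have [->|bin1_gt0] := posnP 'C((bin_period m k).-1, i).
  by rewrite muln0 => /esym/eqP; rewrite muln_eq0 /= eqn0Ngt bin_gt0.
move=> diag; apply/(dvdn_partP _ m_gt0) => p pi_p; rewrite p_part.
have prp : prime p by move: pi_p; rewrite mem_primes => /andP[].
rewrite pfactor_dvdn //; move/(congr1 (logn p)): diag.
rewrite (lognM p (bin_period_gt0 k m_gt0) bin1_gt0) (lognM p _ bin_gt0) //.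
move=> diag.
have log_i : logn p i.+1 <= trunc_log p k.
  apply: trunc_log_max (prime_gt1 prp) _; apply: leq_trans ltik.
  by apply: dvdn_leq => //; apply: pfactor_dvdnn.
have: logn p m + trunc_log p k <= logn p (bin_period m k).
  rewrite -pfactor_dvdn ?bin_period_gt0 // expnD dvdn_mul ?pfactor_dvdnn //.
  by rewrite (big_rem p) //= dvdn_mulr.
move=> log_M; rewrite -(leq_add2l (trunc_log p k)) addnC.
apply: leq_trans log_M (leq_trans _ (leq_add log_i (leqnn _))).
by rewrite -diag leq_addr.
Qed.

(** In Vandermonde's identity every term taking at least one element from the added period is
    divisible by [m]; only ['C(w, j)] survives. *)
Lemma bin_add_period m k w j : 0 < m -> j <= k ->
  'C(w + bin_period m k, j) = 'C(w, j) %[mod m].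
Proof.
move=> m_gt0 lejk; rewrite addnC -binomial.Vandermonde big_ord_recl bin0 mul1n.
rewrite subn0 -modnDmr [X in _ + X](_ : _ = 0) ?addn0 //.
apply/eqP; apply: dvdn_sum => i _.
by apply/dvdn_mulr/dvdn_bin_period => //; rewrite lift0 /= (leq_trans _ lejk).
Qed.

Lemma bin_mod_period m k w w' j : 0 < m -> j <= k ->
  w = w' %[mod bin_period m k] -> 'C(w, j) = 'C(w', j) %[mod m].
Proof.
move=> m_gt0 lejk; wlog lew : w w' / w <= w'.
  by move=> W; case: (leqP w w') => [/W//|/ltnW/W{}W /esym/W].
move/eqP; rewrite eq_sym eqn_mod_dvd // => /dvdnP[q E].
rewrite -(subnKC lew) {w' lew}E; elim: q => [|q IHq]; first by rewrite addn0.
by rewrite mulSn [_ + q * _]addnC addnA bin_add_period.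
Qed.

(** * Counting by classes *)

(** A fibre contributes its constant summand times its size, so sizes matter only modulo [m], and
    only where the summand is nonzero. That restriction later confines the comparison to sets of
    size at most [k]. *)
Lemma sum_eq_mod_fibers m (I J : finType) (f f' : I -> J) (F F' : I -> nat) :
    (forall i k, f i = f k -> F i = F k) ->
    (forall i k, f' i = f' k -> F' i = F' k) ->
    (forall i k, f i = f' k -> F i = F' k) ->
    (forall i, F i != 0 ->
       #|[set k | f k == f i]| = #|[set k | f' k == f i]| %[mod m]) ->
    (forall i, F' i != 0 ->
       #|[set k | f k == f' i]| = #|[set k | f' k == f' i]| %[mod m]) ->
  \sum_i F i = \sum_i F' i %[mod m].
Proof.
move=> fF f'F' ff'F card_f card_f'.
rewrite (partition_big f predT) // [in RHS](partition_big f' predT) //=.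
rewrite -modn_summ -[in RHS]modn_summ; congr (_ %% m); apply: eq_bigr => j _.
(* If only one of the two fibres over [j] is empty, the cardinality hypothesis makes the size of the
   other divisible by [m], unless [c = 0]. *)
have [c [Fc F'c cE]] : exists c, [/\ forall i, f i == j -> F i = c,
     forall i, f' i == j -> F' i = c &
     c = 0 \/ #|[set k | f k == j]| = #|[set k | f' k == j]| %[mod m]].
  have [i /eqP fi|no_f] := pickP [pred i | f i == j].
    exists (F i); split=> [k /eqP fk|k /eqP f'k|].
    - by apply: fF; rewrite fk.
    - by apply/esym/ff'F; rewrite f'k.
    - by have [->|/card_f] := eqVneq (F i) 0; [left|rewrite fi; right].
  have [i /eqP f'i|no_f'] := pickP [pred i | f' i == j].
    exists (F' i); split=> [k|k /eqP f'k|].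
    - by have := no_f k => /= ->.
    - by apply: f'F'; rewrite f'k.
    - by have [->|/card_f'] := eqVneq (F' i) 0; [left|rewrite f'i; right].
  exists 0; split=> [k|k|]; last by left.
    by have := no_f k => /= ->.
  by have := no_f' k => /= ->.
rewrite (eq_bigr _ Fc) (eq_bigr _ F'c) !sum_nat_const.
case: cE => [->|]; first by rewrite !muln0.
by rewrite !cardsE => cE; rewrite -modnMml cE modnMml.
Qed.

(** Such a set is the disjoint union of [U] with free choices of [a] points in [X :\: S] and [b]
    points in [~: X :\: S]. *)
Lemma card_set_traces (T : finType) (S X U : {set T}) (a b : nat) :
  U \subset S ->
  #|[set A : {set T} | [&& A :&: S == U, #|A :&: X :\: S| == a
                         & #|A :\: X :\: S| == b]]|
    = 'C(#|X :\: S|, a) * 'C(#|~: X :\: S|, b).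
Proof.
move=> US; rewrite -!cards_draws -cardsX.
rewrite -(@card_in_imset _ _ (fun A => (A :&: X :\: S, A :\: X :\: S))).
  apply: eq_card => -[B D]; apply/imsetP/idP => [[A]|].
    rewrite !inE => /and3P[_ /eqP cB /eqP cD] [-> ->] /=.
    by rewrite cB cD !eqxx !andbT setSD ?subsetIr // setSD // setDE subsetIr.
  rewrite !inE /= => /andP[/andP[/subsetP BX cB] /andP[/subsetP DX cD]].
  have sUBD i : [&& (i \in U) ==> (i \in S), (i \in B) ==> (i \in X :\: S)
                 & (i \in D) ==> (i \in ~: X :\: S)].
    apply/and3P; split; apply/implyP; [|exact: BX|exact: DX].
    exact: (subsetP US).
  have EB : (U :|: B :|: D) :&: X :\: S = B.
    apply/setP=> i; move: (sUBD i); rewrite !inE.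
    by do 5!case: (i \in _).
  have ED : (U :|: B :|: D) :\: X :\: S = D.
    apply/setP=> i; move: (sUBD i); rewrite !inE.
    by do 5!case: (i \in _).
  exists (U :|: B :|: D); rewrite ?EB ?ED // !inE EB ED cB cD !andbT.
  apply/eqP/setP=> i; move: (sUBD i); rewrite !inE.
  by do 5!case: (i \in _).
move=> A A'; rewrite !inE => /and3P[/eqP AS _ _] /and3P[/eqP A'S _ _] [EB ED].
apply/setP=> i; move/setP/(_ i): EB; move/setP/(_ i): ED.
move: AS; rewrite -A'S => /setP/(_ i); rewrite !inE.
by case: (i \in A); case: (i \in A'); case: (i \in X); case: (i \in S).
Qed.

(** Equal fibre sizes mean that the two tuples of values are rearrangements of each other. *)
Lemma perm_of_fibers n (K : eqType) (f f' : 'I_n -> K) :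
    (forall k, #|[set i | f i == k]| = #|[set i | f' i == k]|) ->
  exists s : 'S_n, forall i, f' (s i) = f i.
Proof.
move=> card_f.
have: perm_eq [tuple f i | i < n] [tuple f' i | i < n].
  apply/allP => k _ /=; rewrite !count_map; apply/eqP.
  have := card_f k; rewrite !cardsE !cardE !size_filter -!enumT.
  by congr (_ = _); apply: eq_count => i.
case/tuple_permP => s E; exists s => i.
have := congr1 (fun t => tnth t i) (val_inj E).
by rewrite !tnth_mktuple => ->.
Qed.

(** * The action of permutations on gates and their supports *)

Lemma is_supportP n (D : {set 'S_n}) (A : {set 'I_n}) :
  reflect (forall p : 'S_n, (forall i, i \in A -> p i = i) -> p \in D)
          (is_support D A).
Proof.
apply: (iffP forallP) => [H p fixA | H p]; last first.
  by apply/implyP => /forall_inP fixA; apply: H => i /fixA/eqP.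
by apply: (implyP (H p)); apply/forall_inP => i /fixA ->.
Qed.

Lemma unset1_Some (T : finType) (A : {set T}) x :
  unset1 A = Some x <-> A = [set x].
Proof.
rewrite /unset1; split=> [|->].
  case: ifP => // /cards1P[y ->]; case: pickP => // z.
  by rewrite inE => /eqP-> [->].
by rewrite cards1 eqxx; case: pickP => [z /set1P->|/(_ x)] //; rewrite set11.
Qed.

Section GatePerm.
Variables (m n : nat) (C : circuit m n).
Hypotheses (symC : Sym_symmetric C) (rigC : rigid C).
Implicit Types (p q : 'S_n) (g : gate C) (x : 'I_n -> bool).

Lemma gate_perm_input p i : gate_perm C p (input C i) = input C (p i).
Proof. by case/andP: (gate_permP p symC) => _ /forallP/(_ i)/eqP. Qed.

Lemma gate_perm_label p g : label (gate_perm C p g) = label g.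
Proof. by case/andP: (gate_permP p symC) => /and3P[/forallP/(_ g)/eqP]. Qed.

Lemma gate_perm_mult p c d :
  mult (gate_perm C p c) (gate_perm C p d) = mult c d.
Proof.
by case/andP: (gate_permP p symC) => /and3P[_ /forallP/(_ c)/forallP/(_ d)/eqP].
Qed.

Lemma gate_perm_output p : gate_perm C p (output C) = output C.
Proof. by case/andP: (gate_permP p symC) => /and3P[_ _ /eqP]. Qed.

(** Both sides extend [p * q], so rigidity identifies them. *)
Lemma gate_permM p q : gate_perm C (p * q) = (gate_perm C p * gate_perm C q)%g.
Proof.
apply: (gate_perm_uniq rigC (gate_permP _ symC)); apply/andP; split.
  apply/and3P; split.
  - by apply/forallP => g; rewrite permM !gate_perm_label.
  - by apply/forallP => c; apply/forallP => d; rewrite !permM !gate_perm_mult.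
  - by rewrite permM !gate_perm_output.
by apply/forallP => i; rewrite !permM !gate_perm_input.
Qed.

Lemma gate_perm1 : gate_perm C 1 = 1%g.
Proof. by apply: (mulgI (gate_perm C 1)); rewrite -gate_permM !mulg1. Qed.

Lemma gate_permV p : gate_perm C p^-1 = (gate_perm C p)^-1%g.
Proof.
by apply/eqP; rewrite eq_sym eq_invg_mul -gate_permM mulgV gate_perm1.
Qed.

Lemma Stab_gate_perm p q g :
  (q \in Stab (gate_perm C p g)) = ((p * q * p^-1)%g \in Stab g).
Proof.
by rewrite !inE !gate_permM !permM gate_permV (can2_eq (permKV _) (permK _)).
Qed.

Lemma is_support_gate_perm p g (A : {set 'I_n}) :
  is_support (Stab g) A -> is_support (Stab (gate_perm C p g)) (p @: A).
Proof.
move/is_supportP=> suppA; apply/is_supportP => q fix_q; rewrite Stab_gate_perm.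
by apply: suppA => i Ai; rewrite !permM fix_q ?permK ?imset_f.
Qed.

Lemma imset_permK p (A : {set 'I_n}) : p^-1%g @: (p @: A) = A.
Proof.
rewrite -imset_comp -[RHS]imset_id.
by apply: eq_imset => i /=; rewrite permK.
Qed.

Lemma minimal_supports_gate_perm p g (A : {set 'I_n}) :
  A \in minimal_supports (Stab g) ->
  p @: A \in minimal_supports (Stab (gate_perm C p g)).
Proof.
rewrite !inE card_imset; last exact: perm_inj.
case/andP=> /minsetP[suppA minA] ->; rewrite andbT; apply/minsetP.
split=> [|B suppB sBA]; first exact: is_support_gate_perm.
suff <- : p^-1%g @: B = A by rewrite -{1}(invgK p) imset_permK.
apply: minA.
  by rewrite -[g](permK (gate_perm C p)) -gate_permV is_support_gate_perm.
by rewrite -[A](imset_permK p) imsetS.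
Qed.

(** The stabilisers of [g] and of its image are conjugate, so [p] carries minimal supports to
    minimal supports and [p^-1] carries them back; uniqueness is transported as well. *)
Lemma supp_gate_perm p g (A : {set 'I_n}) :
  supp g = Some A -> supp (gate_perm C p g) = Some (p @: A).
Proof.
move/unset1_Some => suppA; apply/unset1_Some/eqP.
rewrite eqEsubset sub1set minimal_supports_gate_perm ?suppA ?set11 // andbT.
apply/subsetP => B /(minimal_supports_gate_perm p^-1).
rewrite gate_permV permK suppA => /set1P <-.
by rewrite -{1}(invgK p) imset_permK set11.
Qed.

Lemma supp_min g (A : {set 'I_n}) :
  supp g = Some A -> A \in minimal_supports (Stab g).
Proof. by move/unset1_Some->; rewrite set11. Qed.

Lemma supp_fix g (A : {set 'I_n}) p :
  supp g = Some A -> (forall i, i \in A -> p i = i) -> gate_perm C p g = g.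
Proof.
move/supp_min; rewrite inE => /andP[/minsetP[/is_supportP suppA _] _] /suppA.
by rewrite inE => /eqP.
Qed.

Lemma supp_input i (A : {set 'I_n}) :
  1 < n -> supp (input C i) = Some A -> i \in A.
Proof.
move=> n_gt1 suppA; apply/negPn/negP => nAi.
have := supp_min suppA; rewrite inE => /andP[_ ltAn].
(* As [A] has fewer than n/2 elements and n > 1, some [j] lies outside [i |: A]; the transposition
   of [i] and [j] then fixes [A] pointwise but moves the input gate. *)
have [j] : exists j, j \in ~: (i |: A).
  apply/set0Pn; rewrite -card_gt0 cardsCs setCK card_ord cardsU1 nAi subn_gt0.
  case: #|A| ltAn => [|a]; first by rewrite addn0.
  rewrite add1n -addnn; apply: leq_ltn_trans.
  by rewrite addSn addnS !ltnS leq_addr.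
rewrite !inE negb_or => /andP[neqji nAj].
have /(supp_fix suppA) : forall k, k \in A -> tperm i j k = k.
  by move=> k Ak; rewrite tpermD //; apply: contraTneq Ak => <-.
by rewrite gate_perm_input tpermL => -[/eqP]; rewrite (negPf neqji).
Qed.

Lemma supp_output (A : {set 'I_n}) : supp (output C) = Some A -> A = set0.
Proof.
move/supp_min; rewrite inE => /andP[/minsetP[_ minA] _]; apply/esym/minA.
  by apply/is_supportP => p _; rewrite inE gate_perm_output.
exact: sub0set.
Qed.

Lemma iter_step_gate_perm p x k g :
  iter k (step x) (fun _ => false) (gate_perm C p g)
    = iter k (step (fun i => x (p i))) (fun _ => false) g.
Proof.
elim: k g => [|k IHk] //= [i|h]; first by rewrite gate_perm_input.
have := gate_perm_label p (inr h); have := gate_perm_mult p ^~ (inr h).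
case: (gate_perm C p (inr h)) => //= h' E [->]; congr MOD.
rewrite (reindex_inj (@perm_inj _ (gate_perm C p))) /=; apply: eq_bigr => c _.
by rewrite IHk; congr (_ * _); apply: E.
Qed.

End GatePerm.

(** * Transitivity on classes, and weights outside a fixed set *)

(** This is the transitivity on a class, for two inputs at once. The inputs are matched only on [T],
    so no relation between their total weights is required. *)
Lemma perm_of_traces n (A T T' X X' : {set 'I_n}) :
    T :&: A = T' :&: A ->
    #|T :&: X :\: A| = #|T' :&: X' :\: A| ->
    #|T :\: X :\: A| = #|T' :\: X' :\: A| ->
  exists s : 'S_n, [/\ forall i, i \in A -> s i = i,
    forall i, (s i \in T') = (i \in T) &
    forall i, i \in T :\: A -> (s i \in X') = (i \in X)].
Proof.
move=> TA card1 card0.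
(* Points of [A] are coloured by themselves, which forces [s] to fix them; outside [B] the colour
   ignores [Y]. *)
pose f (B Y : {set 'I_n}) i : 'I_n + bool * bool :=
  if i \in A then inl i else inr (i \in B, (i \in B) && (i \in Y)).
have [|s fs] := @perm_of_fibers _ _ (f T X) (f T' X').
  case=> [j|[b1 b2]].
    apply: eq_card => i; rewrite !inE /f; case: ifP => // _; exact: erefl.
  have inr_inj : injective (@inr 'I_n (bool * bool)) by move=> ? ? [].
  have EF B Y : [set i | f B Y i == inr (b1, b2)] =
      if b1 then if b2 then B :&: Y :\: A else B :\: Y :\: A
      else if b2 then set0 else ~: (B :|: A).
    apply/setP => i; rewrite inE /f; case: ifP => iA.
      by case: b1; case: b2; rewrite !inE ?iA ?orbT.
    rewrite (inj_eq inr_inj) xpair_eqE.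
    by case: b1; case: b2; rewrite !inE ?iA; case: (i \in B); case: (i \in Y).
  rewrite !EF {EF}; case: b1; case: b2 => //.
  (* For the points outside both sets, complements reduce the claim to [#|T| = #|T'|], obtained by
     adding up the three traces. *)
  rewrite [LHS]cardsCs [RHS]cardsCs !setCK !cardsU TA; congr (_ - (_ + _ - _)).
  rewrite -(cardsID A T) -(cardsID A T') TA; congr (_ + _).
  rewrite -(cardsID X) -[RHS](cardsID X') !setIDAC card1.
  by rewrite !setDDl setUC -setDDl card0 [in RHS]setUC setDDl.
have sA i : i \in A -> s i = i.
  by move=> iA; move: (fs i); rewrite /f iA; case: ifP => // _ [].
have sNA i : i \notin A -> s i \notin A.
  by move=> niA; move: (fs i); rewrite /f (negPf niA); case: ifP.
exists s; split=> // i.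
  case: (boolP (i \in A)) => iA.
    by rewrite sA //; move/setP/(_ i): TA; rewrite !inE iA !andbT.
  by move: (fs i); rewrite /f (negPf iA) (negPf (sNA _ iA)) => -[].
rewrite inE => /andP[iA iT].
move: (fs i); rewrite /f (negPf iA) (negPf (sNA _ iA)) => -[->].
by rewrite iT.
Qed.

Lemma card_setD_modn (T : finType) (A X X' : {set T}) d :
    X :&: A = X' :&: A -> #|X| = #|X'| %[mod d] ->
  #|X :\: A| = #|X' :\: A| %[mod d].
Proof.
move=> XA; rewrite -(cardsID A X) -(cardsID A X') XA => /eqP.
by rewrite eqn_modDl => /eqP.
Qed.

Lemma card_setCD_modn (T : finType) (A X X' : {set T}) d :
    X :&: A = X' :&: A -> #|X| = #|X'| %[mod d] ->
  #|~: X :\: A| = #|~: X' :\: A| %[mod d].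
Proof.
move=> XA /(card_setD_modn XA) /eqP cardD.
have E Y : #|Y :\: A| + #|~: Y :\: A| = #|~: A|.
  by rewrite -(cardsID Y (~: A)) !setDE [~: A :&: Y]setIC [~: A :&: ~: Y]setIC.
apply/eqP; rewrite -(eqn_modDl #|X :\: A|) E -(E X').
by rewrite eqn_modDr eq_sym.
Qed.

(** * Gate values depend on the support bits and a periodic weight *)

Section Periodicity.
Variables (m n : nat) (C : circuit m n) (k : nat).
Hypotheses (symC : Sym_symmetric C) (rigC : rigid C).
Hypotheses (m_gt1 : 1 < m) (n_gt1 : 1 < n).
Hypothesis suppC : forall g : gate C, supp_defined g.
Hypothesis supp_le : forall (g : gate C) (A : {set 'I_n}),
  supp g = Some A -> #|A| <= k.

(** Induction on the round [l] plays the role of induction on depth. The inputs stay general because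
    the induction hypothesis is applied to a child with one input permuted. *)
Lemma iter_step_periodic l (g : gate C) (A : {set 'I_n}) (x x' : 'I_n -> bool) :
    supp g = Some A -> {in A, x =1 x'} ->
    #|[set i | x i]| = #|[set i | x' i]| %[mod bin_period m k] ->
  iter l (step x) (fun _ => false) g = iter l (step x') (fun _ => false) g.
Proof.
elim: l g A x x' => [//|l IHl] [i|h] A x x' suppA xx' cardx /=.
  by apply: xx'; apply: supp_input suppA.
pose v y : gate C -> bool := iter l (step y) (fun _ => false).
pose T (c : gate C) := odflt set0 (supp c).
have suppT c : supp c = Some (T c) by rewrite /T; have [B ->] := suppC c.
pose G y B := \sum_(c : gate C | T c == B) wires c h * v y c.
suff EG : \sum_B G x B = \sum_B G x' B %[mod m].
  have sumG y : \sum_(c : gate C) wires c h * v y c = \sum_B G y B.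
    by rewrite /G (partition_big T predT).
  by rewrite /MOD !sumG -(Zp_nat_mod m_gt1) EG Zp_nat_mod.
pose X y := [set i : 'I_n | y i].
have m_gt0 : 0 < m := ltnW m_gt1.
(* This is the class of [B]. The [inord] only makes the type of classes finite: the sizes are at
   most [n], so nothing is truncated. *)
pose f y B : {set 'I_n} * 'I_n.+1 * 'I_n.+1 :=
  (B :&: A, inord #|B :&: X y :\: A|, inord #|B :\: X y :\: A|).
have inord_eq (B B' : {set 'I_n}) :
    ((inord #|B| : 'I_n.+1) == inord #|B'|) = (#|B| == #|B'|).
  have lt_n (D : {set 'I_n}) : #|D| < n.+1.
    by rewrite ltnS -[n in _ <= n]card_ord max_card.
  by rewrite -val_eqE /= !inordK ?lt_n.
(* The permutation [s] fixes [A], hence the gate [inr h], and maps the children with support [B]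
   onto those with support [B']. The input [y'] composed with [s] agrees with [y] on [B] and has the
   weight of [y'], so the induction hypothesis applies. *)
have GG y y' B B' : {in A, y =1 y'} ->
    #|X y| = #|X y'| %[mod bin_period m k] -> f y B = f y' B' ->
    G y B = G y' B'.
  move=> yy' cardy [BA /eqP + /eqP]; rewrite !inord_eq => /eqP card1 /eqP card0.
  have [s [sA sB sX]] := perm_of_traces BA card1 card0.
  have sh : gate_perm C s (inr h) = inr h by apply: supp_fix suppA sA.
  rewrite /G [RHS](reindex_inj (@perm_inj _ (gate_perm C s))) /=.
  have sBB' : s @: B = B'.
    apply/setP=> i; rewrite -(permKV s i) sB mem_imset //; exact: perm_inj.
  apply: eq_big => c.
    rewrite /T (supp_gate_perm symC rigC s (suppT c)) suppT /= -sBB'.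
    by rewrite (inj_eq (imset_inj (@perm_inj _ s))).
  move=> /eqP Tc; congr (_ * nat_of_bool _).
    by have := gate_perm_mult symC s c (inr h); rewrite sh.
  rewrite /v (iter_step_gate_perm symC); apply: (IHl _ B).
  - by rewrite suppT Tc.
  - move=> i iB; case: (boolP (i \in A)) => iA; first by rewrite sA // yy'.
    by have := sX i; rewrite !inE iA iB => /(_ isT) ->.
  - rewrite -/(X y) cardy; congr (_ %% _).
    rewrite -(card_preimset (X y') (@perm_inj _ s)).
    by apply: eq_card => i; rewrite !inE.
have card_fiber y y' B : #|[set D | f y' D == f y B]| =
    'C(#|X y' :\: A|, #|B :&: X y :\: A|)
      * 'C(#|~: X y' :\: A|, #|B :\: X y :\: A|).
  rewrite -(card_set_traces _ _ _ (subsetIr B A)).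
  by apply: eq_card => D; rewrite !inE /f !xpair_eqE !inord_eq andbA.
(* A nonzero contribution means that [B] is the support of some gate, which bounds the lower indices
   of the binomials by [k]. *)
have G_le y B : G y B != 0 -> #|B| <= k.
  rewrite /G; have [c /eqP Tc _|noc] := pickP (fun c => T c == B).
    by apply: (@supp_le c); rewrite suppT Tc.
  by rewrite big_pred0.
have XA : X x :&: A = X x' :&: A.
  apply/setP=> i; rewrite !inE.
  by case: (boolP (i \in A)) => [/xx'->|]; rewrite ?andbF.
have le_k y B : G y B != 0 ->
    #|B :&: X y :\: A| <= k /\ #|B :\: X y :\: A| <= k.
  move/G_le=> leB; split; apply: leq_trans leB; apply: subset_leq_card.
    by rewrite -setIDAC subIset ?subsetDl.
  by rewrite setDDl subsetDl.
have eq_fiber y B : G y B != 0 ->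
    #|[set D | f x D == f y B]| = #|[set D | f x' D == f y B]| %[mod m].
  case/le_k=> le1 le0; rewrite !card_fiber -modnMml -modnMmr.
  rewrite (bin_mod_period m_gt0 le1 (card_setD_modn XA cardx)).
  rewrite (bin_mod_period m_gt0 le0 (card_setCD_modn XA cardx)).
  by rewrite modnMml modnMmr.
apply: (@sum_eq_mod_fibers _ _ _ (f x) (f x')) => [B B'|B B'|B B'|B|B].
1-3: by apply: GG.
1-2: exact: eq_fiber.
Qed.

Lemma not_computes_AND : bin_period m k <= n -> ~ computes C (@AND n).
Proof.
move=> le_n compC; have [A suppA] := suppC (output C).
have M_gt0 : 0 < bin_period m k by rewrite bin_period_gt0 // ltnW.
(* This input vanishes exactly on the first [bin_period m k] variables, so its weight is congruent
   to [n] but it is not all ones. *)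
pose y (i : 'I_n) := bin_period m k <= i.
have: eval (fun _ => true) (output C) = eval y (output C).
  apply: (iter_step_periodic _ suppA).
    by move=> i; rewrite (supp_output symC suppA) inE.
  have -> : [set i : 'I_n | true] = setT by apply/setP=> i; rewrite !inE.
  have -> : [set i | y i] = ~: [set widen_ord le_n i | i : 'I_(bin_period m k)].
    apply/setP=> i; rewrite !inE /y leqNgt; congr (~~ _).
    apply/idP/imsetP => [lti|[j _ ->]] //=.
    by exists (Ordinal lti) => //; apply: val_inj.
  rewrite cardsT cardsCs setCK card_imset; last first.
    by move=> i j /(congr1 val) /= /val_inj.
  by rewrite !card_ord -{1}(subnK le_n) modnDr.
rewrite !compC /AND; have -> : [forall i : 'I_n, true] by apply/forallP.
by move/esym/forallP/(_ (Ordinal (ltnW n_gt1))); rewrite /y /= leqNgt M_gt0.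
Qed.

End Periodicity.

(** * From the real bound to the period bound, and the conclusion *)

Local Open Scope ring_scope.
Import Order.TTheory GRing.Theory Num.Theory.

Lemma natr_lt_powR_root (R : realType) (k m n r : nat) :
  (0 < m)%N -> (0 < r)%N ->
  k%:R < powR (n%:R / m%:R : R) (r%:R^-1) -> (m * k ^ r < n)%N.
Proof.
move=> m_gt0 r_gt0 ltk; have a_ge0 : 0 <= n%:R / m%:R :> R by rewrite divr_ge0.
have := gt0_ltr_powR (r := r%:R) _ _ _ ltk.
rewrite !nnegrE powR_ge0 ler0n ltr0n -powRrM mulVf ?pnatr_eq0 -?lt0n //.
rewrite powRr1 // powR_mulrn // => /(_ r_gt0 isT isT).
by rewrite ltr_pdivlMr ?ltr0n // -natrX -natrM ltr_nat mulnC.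
Qed.

Theorem theorem3p1 (R : realType) (m : nat) (hm : (3 < m)%N)
    (C : forall n : nat, circuit m n)
    (hsym : forall n : nat, Sym_symmetric (C n))
    (hrigid : forall n : nat, rigid (C n))
    (n : nat) (hn : (1 < n)%N)
    (hsupp : forall g : gate (C n), supp_defined g)
    (hbound : (max_supp_size (C n))%:R <
       powR (n%:R / m%:R : R) ((size (primes m))%:R^-1)) :
  ~ computes (C n) (@AND n).
Proof.
have m_gt1 : (1 < m)%N by apply: leq_trans hm.
have supp_le (g : gate (C n)) (A : {set 'I_n}) :
    supp g = Some A -> (#|A| <= max_supp_size (C n))%N.
  move=> suppA; apply: leq_trans (leq_bigmax g).
  by rewrite /supp_size suppA.
(* Positivity is needed to bound each factor [p ^ trunc_log p k] by [k]; it comes from an input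
   gate, whose support contains its own variable. *)
have k_gt0 : (0 < max_supp_size (C n))%N.
  pose i := Ordinal hn; have [A suppA] := hsupp (input (C n) i).
  apply: leq_trans (supp_le _ _ suppA); rewrite card_gt0; apply/set0Pn.
  by exists i; apply: supp_input suppA.
have r_gt0 : (0 < size (primes m))%N.
  by rewrite lt0n size_eq0 primes_eq0 -leqNgt.
apply: (not_computes_AND (hsym n) (hrigid n) m_gt1 hn hsupp supp_le).
apply: leq_trans (bin_period_le _ k_gt0) (ltnW _).
exact: natr_lt_powR_root (ltnW m_gt1) r_gt0 hbound.
Qed.
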